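(* For every $m\in\mathbb N$ there exists $n\in\mathbb N$ such that for every coloring of $\mathbb R^n$ (with an arbitrary, possibly infinite, number of colors) there exists a Euclidean isometric copy of $I^m$ in $\mathbb R^n$ that is either monochromatic or rainbow.
   Context: $I^m$ denotes the vertex set of an $m$-dimensional hypercube of side length $1$ (e.g. $\{0,1\}^m\subset\mathbb R^m$). An isometric copy of $A\subset\mathbb R^m$ in $\mathbb R^n$ is a set $A'\subset\mathbb R^n$ with a bijection $f:A\to A'$ preserving Euclidean distances. A set of points is monochromatic if all its points have the same color and rainbow if all its points have pairwise distinct colors. *)

(* Defs.v *)
(* MathComp / MathComp-Analysis *)
From mathcomp Require Import all_boot all_order all_algebra.
From mathcomp Require Import all_classical all_reals.

Set Implicit Arguments.
Unset Strict Implicit.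
Unset Printing Implicit Defensive.

Import Order.TTheory GRing.Theory Num.Theory.

Local Open Scope classical_set_scope.
Local Open Scope ring_scope.

(* Defined by hand: the norm MathComp-Analysis puts on 'rV[R]_n is the sup
   norm, not the Euclidean one. *)
Definition edist (R : realType) (n : nat) (x y : 'rV[R]_n) : R :=
  Num.sqrt (\sum_(i < n) (x 0 i - y 0 i) ^+ 2).

Definition cube (R : realType) (m : nat) : set 'rV[R]_m :=
  [set x | forall i : 'I_m, x 0 i = 0 \/ x 0 i = 1].
Arguments cube : clear implicits.

(* The bijection A -> A' is the restriction to A of a total function f; its
   values outside A are unconstrained. *)
Definition isometric_copy (R : realType) (m n : nat)
    (A : set 'rV[R]_m) (A' : set 'rV[R]_n) : Prop :=
  exists f : 'rV[R]_m -> 'rV[R]_n,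
    set_bij A A' f /\
    (forall x y, A x -> A y -> edist (f x) (f y) = edist x y).

Definition monochromatic (T C : Type) (c : T -> C) (A : set T) : Prop :=
  forall x y, A x -> A y -> c x = c y.

Definition rainbow (T C : Type) (c : T -> C) (A : set T) : Prop :=
  forall x y, A x -> A y -> x <> y -> c x <> c y.

(* Main.v *)
(** Identify [s] in [[N]^k] with the point [(1/sqrt 2) * sum_t e_(t, s_t)] of
    [R^(k N)]: the squared distance of two such points is the Hamming distance
    of the words, so a subcube with two letters allowed in each of [m]
    positions and the other positions fixed is a copy of [I^m].  By a canonical
    Ramsey theorem for products, for [N] large some box [prod_t {p_t, q_t}]
    carries a set [J] of positions such that two of its words have the same
    colour iff they agree on [J].  For [k = 2m], either [J] or its complement
    has at least [m] elements; letting [m] positions vary there gives a rainbow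
    cube in the first case and a monochromatic one in the second. *)
Require Import Defs.
From mathcomp Require Import all_boot all_order all_algebra.
From mathcomp Require Import all_classical all_reals.

(** * Ramsey's theorem for pairs *)

Lemma pigeonhole_count (T : Type) (K : finType) (h : T -> K) n (s : seq T) :
  #|K| * n < size s -> exists k, n < count (fun x => h x == k) s.
Proof.
move=> lt_s; suff /existsP[k lt_n] : [exists k, n < count (fun x => h x == k) s].
  by exists k.
apply: contraTT lt_s => /existsPn le_n; rewrite -leqNgt.
have -> : size s = \sum_(k : K) count (fun x => h x == k) s.
  elim: s {le_n} => [|x s IHs] /=; first by rewrite big1.
  rewrite big_split /= -IHs (bigD1 (h x)) //= eqxx big1 // => k.
  by rewrite eq_sym => /negbTE->.
rewrite -sum_nat_const; apply: leq_sum => k _; rewrite leqNgt; exact: le_n.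
Qed.

(** Greedy choice: keep the head of the list, pass to a large colour class of its tail, and repeat.
    Each chosen element carries the colour that it gives with all later ones. *)
Lemma end_homogeneous (K : finType) n : exists N, forall (T : eqType)
    (f : T -> T -> K) (s : seq T), N <= size s ->
  exists t : seq (T * K),
    [/\ size t = n, subseq (map fst t) s
      & pairwise (fun p q => f p.1 q.1 == p.2) t].
Proof.
elim: n => [|n [N IHn]].
  by exists 0 => T f s _; exists [::]; rewrite /= sub0seq.
exists (#|K| * N).+2 => T f [//|x s]; rewrite ltnS => lt_s.
have [k lt_N] := @pigeonhole_count T K (f x) N s lt_s.
have [|t [size_t sub_t hom_t]] := IHn T f [seq y <- s | f x y == k].
  by rewrite size_filter ltnW.
exists ((x, k) :: t); split; rewrite /= ?size_t //.
  by rewrite eqxx (subseq_trans sub_t) ?filter_subseq.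
rewrite hom_t andbT; apply/allP => q t_q.
have := mem_subseq sub_t (map_f fst t_q).
by rewrite mem_filter => /andP[].
Qed.

(** Pigeonhole on the colours recorded by [end_homogeneous] leaves elements that all record the same
    one. *)
Lemma ramsey_pairs (K : finType) n : exists N, forall (T : eqType)
    (f : T -> T -> K) (s : seq T), N <= size s ->
  exists (k : K) (t : seq T),
    [/\ n <= size t, subseq t s & pairwise (fun x y => f x y == k) t].
Proof.
have [N ehN] := end_homogeneous K (#|K| * n).+1.
exists N => T f s le_s; have [t [size_t sub_t hom_t]] := ehN T f s le_s.
have [|k lt_n] := @pigeonhole_count _ K snd n t; first by rewrite size_t.
pose t' := [seq p <- t | p.2 == k].
exists k, (map fst t'); split.
- by rewrite size_map size_filter ltnW.
- by apply: subseq_trans sub_t; rewrite map_subseq ?filter_subseq.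
have : pairwise (fun p q => f p.1 q.1 == p.2) t'.
  by apply: subseq_pairwise hom_t; apply: filter_subseq.
have : all (fun p => p.2 == k) t' by apply: filter_all.
rewrite pairwise_map; elim: t' => //= p u IHu /andP[/eqP p2 /IHu{}IHu].
by case/andP=> all_p /IHu->; rewrite andbT -p2.
Qed.

(** * Canonical Ramsey theorem for boxes *)

Definition box_vertex (b : seq (nat * nat)) (x : seq bool) : seq nat :=
  [seq if p.2 then p.1.2 else p.1.1 | p <- zip b x].

(** Facts proved for all tuples, which form a finite type, thereby apply to box vertices. *)
Lemma box_vertex_tuple k N b x :
    size b = k -> size x = k -> all (fun p => p.1 < p.2 < N) b ->
  exists z : k.-tuple 'I_N, box_vertex b x = map val z.
Proof.
move=> <-{k}; elim: b x => [|[p q] b IHb] [|a x] //= => [_|].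
  by exists [tuple].
case=> /IHb{}IHb /andP[/andP[lt_pq lt_qN] /IHb[z ez]].
have lt_N : (if a then q else p) < N.
  by case: a => //; apply: ltn_trans lt_pq lt_qN.
by exists [tuple of Ordinal lt_N :: z]; rewrite /box_vertex /= -ez.
Qed.

(* The auxiliary finite colouring [h] is there for the induction: it records
   whether the colour is constant or injective along the new coordinate. *)
Lemma canonical_box k (K : finType) : exists N,
  forall (C : Type) (c : seq nat -> C) (h : seq nat -> K),
  exists (b : seq (nat * nat)) (J : bitseq),
    [/\ size b = k, size J = k, all (fun p => p.1 < p.2 < N) b
      & forall x y : bitseq, size x = k -> size y = k ->
          h (box_vertex b x) = h (box_vertex b y) /\
          (c (box_vertex b x) = c (box_vertex b y) <-> mask J x = mask J y)].
Proof.
elim: k K => [|k IHk] K.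
  by exists 0 => C c h; exists [::], [::]; split=> // [[|//] [|//]].
have [N0 {}IHk] := IHk (K * bool)%type.
pose X := k.-tuple 'I_N0.
(* Three first letters are sought: [i0] and [i1] span the new side of the box, and [i2] is a third
   slice to compare them with. *)
have [N1 ramN] := ramsey_pairs ({ffun X * X -> bool * bool} * {ffun X -> K})%type 3.
exists (maxn N0 N1) => C c h.
pose w i (x : X) := i :: map val x.
(* [C] may be infinite, but the pattern of colour equalities between slices [i] and [j] and within
   slice [i] takes finitely many values, since [X] is finite. *)
pose f i j := ([ffun z : X * X => (`[< c (w i z.1) = c (w j z.2) >],
                                   `[< c (w i z.1) = c (w i z.2) >])],
               [ffun x : X => h (w i x)]).
have [|[g h0] [t [size_t sub_t hom_t]]] := ramN _ f (iota 0 N1).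
  by rewrite size_iota.
case: t size_t sub_t hom_t => [|i0 [|i1 [|i2 t]]] //= _ sub_t.
move=> /andP[/and3P[/eqP f01 /eqP f02 _] /andP[/andP[/eqP f12 _] _]].
have lt_01 : i0 < i1.
  have := subseq_sorted ltn_trans sub_t (iota_ltn_sorted 0 N1).
  by case/andP.
have lt_1N : i1 < N1.
  have : i1 \in iota 0 N1 by apply: (mem_subseq sub_t); rewrite !inE eqxx orbT.
  by rewrite mem_iota.
have tab i j : f i j = (g, h0) -> forall x y : X,
    [/\ g (x, y) = (`[< c (w i x) = c (w j y) >], `[< c (w i x) = c (w i y) >])
      & h0 x = h (w i x)].
  by case=> <- <- x y; rewrite !ffunE.
pose c' s := c (i0 :: s).
(* The boolean tells whether changing the first letter from [i0] to [i1] preserves the colour; the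
   induction makes the answer uniform on the box. *)
pose h' s := (h (i0 :: s), `[< c (i0 :: s) = c (i1 :: s) >]).
have [b [J [size_b size_J lt_b can_b]]] := IHk C c' h'.
have hE (x : X) : h (w i1 x) = h (w i0 x).
  by have [_ <-] := tab _ _ f12 x x; have [_ <-] := tab _ _ f01 x x.
have cE (x y : X) : (c (w i1 x) = c (w i1 y)) <-> (c (w i0 x) = c (w i0 y)).
  have [eg _] := tab _ _ f12 x y; have [] := tab _ _ f01 x y.
  by rewrite eg => -[_ e] _; apply: asbool_eq_equiv.
have c02 (x y : X) : (c (w i0 x) = c (w i2 y)) <-> (c (w i0 x) = c (w i1 y)).
  have [eg _] := tab _ _ f02 x y; have [] := tab _ _ f01 x y.
  by rewrite eg => -[e] _; apply: asbool_eq_equiv.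
have c12 (x y : X) : (c (w i1 x) = c (w i2 y)) <-> (c (w i0 x) = c (w i1 y)).
  have [eg _] := tab _ _ f12 x y; have [] := tab _ _ f01 x y.
  by rewrite eg => -[e _] _; apply: asbool_eq_equiv.
(* By homogeneity [w i0 x] also has the colour of [w i2 y]. Hence slices [i1] and [i2] agree at [y],
   and by homogeneity so do [i0] and [i1]. *)
have cross (x y : X) : c (w i0 x) = c (w i1 y) -> c (w i0 y) = c (w i1 y).
  by move=> exy; apply/c12; rewrite -exy; apply/c02.
(* The all-false vertex is an arbitrary representative. The new position enters [J] exactly when the
   first letter affects the colour. *)
pose e := (h' (box_vertex b (nseq k false))).2.
exists ((i0, i1) :: b), (~~ e :: J); split=> /=; rewrite ?size_b ?size_J //.
  rewrite lt_01 leq_max lt_1N orbT /=.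
  apply: sub_all lt_b => p /andP[-> lt_p] /=.
  by rewrite leq_max lt_p.
move=> [|a x] [|a' y] //= [size_x] [size_y].
have [h'xy c'xy] := can_b x y size_x size_y.
have [h'x0 _] := can_b x (nseq k false) size_x (size_nseq _ _).
have [h'y0 _] := can_b y (nseq k false) size_y (size_nseq _ _).
have {h'x0} ex : (h' (box_vertex b x)).2 = e by rewrite h'x0.
have {h'y0} ey : (h' (box_vertex b y)).2 = e by rewrite h'y0.
have vE a0 (z : bitseq) : box_vertex ((i0, i1) :: b) (a0 :: z) =
  (if a0 then i1 else i0) :: box_vertex b z by [].
rewrite !vE {vE}; move: e ex ey h'xy c'xy.
have [x' ->] := box_vertex_tuple _ _ _ _ size_b size_x lt_b.
have [y' ->] := box_vertex_tuple _ _ _ _ size_b size_y lt_b.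
rewrite /h' /c' -!/(w _ _) => e /= ex ey [hxy _] cxy; split.
  by case: a; case: a'; rewrite ?hE.
(* If [e] holds, every first letter may be replaced by [i0]. Otherwise [cross] excludes equal
   colours for different first letters. *)
case: e ex ey => /= [/asboolP ex /asboolP ey|/asboolP nex /asboolP ney].
  by rewrite -cxy; case: a; case: a'; rewrite -?ex -?ey.
case: a; case: a' => /=.
- rewrite cE cxy; split=> [->//|[]//].
- by split=> // /esym/cross/nex.
- by split=> // /cross/ney.
- by rewrite cxy; split=> [->//|[]//].
Qed.

(** * Hamming distance and words spread over chosen positions *)

Definition hamming (T : eqType) (s s' : seq T) : nat :=
  count (fun p => p.1 != p.2) (zip s s').
Arguments hamming {T}.

Lemma hamming_sum_nth (T : eqType) (x0 : T) k (s s' : seq T) :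
    size s = k -> size s' = k ->
  hamming s s' = \sum_(t < k) (nth x0 s t != nth x0 s' t).
Proof.
move=> <-{k}; elim: s s' => [|a s IHs] [|a' s'] //= => [_|[/IHs{}IHs]].
  by rewrite big_ord0.
by rewrite big_ord_recl /= -IHs.
Qed.

Lemma hamming_box_vertex k N b x y :
    size b = k -> size x = k -> size y = k -> all (fun p => p.1 < p.2 < N) b ->
  hamming (box_vertex b x) (box_vertex b y) = hamming x y.
Proof.
move=> <-{k}; elim: b x y => [|[p q] b IHb] [|a x] [|a' y] //=.
case=> size_x [size_y] /andP[/andP[lt_pq _] lt_b].
rewrite /hamming /= -!/(box_vertex _ _) -!/(hamming _ _) IHb //; congr (_ + _)%N.
by case: a; case: a'; rewrite ?eqxx ?(ltn_eqF lt_pq) // eq_sym (ltn_eqF lt_pq).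
Qed.

(* The word [w] is padded with [false] when [J] selects more than [size w]
   positions. *)
Fixpoint spread (J w : bitseq) : bitseq :=
  match J with
  | [::] => [::]
  | true :: J' => head false w :: spread J' (behead w)
  | false :: J' => false :: spread J' w
  end.

Lemma size_spread J w : size (spread J w) = size J.
Proof. by elim: J w => [|[] J IHJ] w //=; rewrite IHJ. Qed.

Lemma hamming_spread J w w' : size w = size w' -> size w <= count id J ->
  hamming (spread J w) (spread J w') = hamming w w'.
Proof.
rewrite /hamming.
elim: J w w' => [|[] J IHJ] [|a w] [|a' w'] //= e le_w.
- by rewrite IHJ.
- by rewrite IHJ //; case: e.
- by rewrite IHJ.
- by rewrite (IHJ (a :: w) (a' :: w')).
Qed.

(** The size bound gives every letter of [w] a position selected by [J], so the mask reads [w]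
    back. *)
Lemma mask_spread_inj J w w' : size w = size w' -> size w <= count id J ->
  mask J (spread J w) = mask J (spread J w') -> w = w'.
Proof.
elim: J w w' => [|[] J IHJ] [|a w] [|a' w'] //= e le_w; last first.
  exact: IHJ.
by case: e => e [-> /IHJ->].
Qed.

(** Letters placed off [J] are invisible to the mask by [J]; this yields the monochromatic cube. *)
Lemma mask_spread_negb J w :
  mask J (spread (map negb J) w) = nseq (count id J) false.
Proof. by elim: J w => [|[] J IHJ] w //=; rewrite IHJ. Qed.

(** * Realisation of words as points of Euclidean space *)

Local Open Scope ring_scope.
Import Order.TTheory GRing.Theory Num.Theory.

Definition point (R : realType) (k N : nat) (s : seq nat) : 'rV[R]_(k * N) :=
  mxvec (\matrix_(t < k, i < N)
           (if nth 0%N s t == i then (Num.sqrt 2)^-1 else 0)).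

(** Each position where the words differ contributes 1/2 + 1/2, from the columns of its two letters;
    the bounds by [N] ensure that these columns exist. *)
Lemma edist_point (R : realType) k N (s s' : seq nat) :
    size s = k -> size s' = k ->
    all (fun i => i < N)%N s -> all (fun i => i < N)%N s' ->
  edist (point R k N s) (point R k N s') = Num.sqrt (hamming s s')%:R.
Proof.
move=> size_s size_s' lt_s lt_s'; rewrite /edist; congr Num.sqrt.
rewrite (reindex _ (curry_mxvec_bij k N)) /=.
rewrite (hamming_sum_nth _ 0%N k) // natr_sum.
transitivity (\sum_(t < k) \sum_(i < N)
    (point R k N s 0 (mxvec_index t i) - point R k N s' 0 (mxvec_index t i)) ^+ 2).
  by rewrite pair_bigA; apply: eq_bigr => -[t i] _.
apply: eq_bigr => t _.
under eq_bigr => i _ do rewrite !mxvecE !mxE.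
have [<-|/eqP neq] := eqVneq; first by rewrite big1 // => i _; rewrite subrr expr0n.
have lt_N : (nth 0 s t < N)%N by apply: (all_nthP 0%N lt_s); rewrite size_s.
have lt_N' : (nth 0 s' t < N)%N by apply: (all_nthP 0%N lt_s'); rewrite size_s'.
have sqrt2V : (Num.sqrt 2)^-1 ^+ 2 = 2^-1 :> R by rewrite exprVn sqr_sqrtr.
rewrite (bigD1 (Ordinal lt_N)) //= (bigD1 (Ordinal lt_N')) /=; last first.
  by apply/eqP=> -[/esym].
rewrite big1 => [|i /andP[/eqP ne1 /eqP ne2]]; last first.
  have /eqP/negbTE-> : nth 0%N s t <> i by move=> e; apply: ne1; apply: val_inj.
  have /eqP/negbTE-> : nth 0%N s' t <> i by move=> e; apply: ne2; apply: val_inj.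
  by rewrite subrr expr0n.
rewrite !eqxx (negbTE (introN eqP neq)) eq_sym (negbTE (introN eqP neq)).
by rewrite subr0 sub0r sqrrN sqrt2V addr0 [RHS]splitr div1r.
Qed.

Lemma edist_eq0 (R : realType) n (x y : 'rV[R]_n) : edist x y = 0 -> x = y.
Proof.
move/eqP; rewrite sqrtr_eq0 => le0; apply/rowP => i; apply/eqP.
have : \sum_(j < n) (x 0 j - y 0 j) ^+ 2 == 0.
  by rewrite eq_le le0 sumr_ge0 // => j _; apply: sqr_ge0.
by rewrite psumr_eq0 => [/allP/(_ i)|j _]; rewrite ?mem_index_enum ?sqr_ge0 //
  sqrf_eq0 subr_eq0; apply.
Qed.

Lemma edistxx (R : realType) n (x : 'rV[R]_n) : edist x x = 0.
Proof. by rewrite /edist big1 ?sqrtr0 // => i _; rewrite subrr expr0n. Qed.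

Definition bits (R : realType) m (x : 'rV[R]_m) : bitseq :=
  [seq x 0 a == 1 | a <- enum 'I_m].
Arguments bits {R m}.

Lemma size_bits (R : realType) m (x : 'rV[R]_m) : size (bits x) = m.
Proof. by rewrite size_map size_enum_ord. Qed.

Lemma edist_cube (R : realType) m (x y : 'rV[R]_m) :
  cube R m x -> cube R m y -> edist x y = Num.sqrt (hamming (bits x) (bits y))%:R.
Proof.
move=> cx cy; rewrite /edist; congr Num.sqrt.
rewrite /hamming zip_map count_map -sum1_count natr_sum big_enum_cond /=.
rewrite [RHS]big_mkcond; apply: eq_bigr => a _ /=.
have ne01 : (0 == 1 :> R) = false by rewrite eq_sym oner_eq0.
by case: (cx a) => ->; case: (cy a) => ->;
  rewrite ?eqxx ?ne01 /= ?subrr ?sub0r ?subr0 ?sqrrN ?expr0n ?expr1n.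
Qed.

Lemma isometric_copy_box (R : realType) m k N b J :
    size b = k -> size J = k -> all (fun p => p.1 < p.2 < N)%N b ->
    (m <= count id J)%N ->
  let f x := point R k N (box_vertex b (spread J (bits x))) in
  isometric_copy (cube R m) (f @` cube R m)%classic.
Proof.
move=> size_b size_J lt_b le_m f.
have size_spr (x : 'rV[R]_m) : size (spread J (bits x)) = k by rewrite size_spread.
have f_isom x y : cube R m x -> cube R m y -> edist (f x) (f y) = edist x y.
  move=> cx cy; rewrite (edist_cube R m x y) //.
  rewrite -(hamming_spread J) ?size_bits //.
  rewrite -(hamming_box_vertex k N b (spread J (bits x)) (spread J (bits y))) //.
  have [u eu] := box_vertex_tuple _ _ _ _ size_b (size_spr x) lt_b.
  have [v ev] := box_vertex_tuple _ _ _ _ size_b (size_spr y) lt_b.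
  by rewrite /f eu ev edist_point ?size_map ?size_tuple // all_map;
    apply/allP => i _ /=.
exists f; split=> //; split.
- by move=> x cx; exists x.
(* Injectivity comes from the isometry: points with equal images are at distance 0. *)
- move=> x y /set_mem cx /set_mem cy fxy.
  by apply: edist_eq0; rewrite -f_isom // fxy edistxx.
- by [].
Qed.

Theorem theorem4 (R : realType) (m : nat) :
  exists n : nat,
    forall (C : Type) (c : 'rV[R]_n -> C),
      exists A' : set 'rV[R]_n,
        isometric_copy (cube R m) A' /\ (monochromatic c A' \/ rainbow c A').
Proof.
have [N can_N] := canonical_box (m + m) unit.
exists ((m + m) * N)%N => C c.
have [b [J [size_b size_J lt_b can_b]]] :=
  can_N C (fun s => c (point R (m + m) N s)) (fun=> tt).
have [le_m | lt_m] := leqP m (count id J).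
  eexists; split; first exact: isometric_copy_box size_b size_J lt_b le_m.
  (* Equal colours force equal masks by [J], hence equal bits and equal points. *)
  right=> _ _ [x cx <-] [y cy <-] neq.
  have [||_ ->] := can_b (spread J (bits x)) (spread J (bits y));
    rewrite ?size_spread // => /mask_spread_inj e.
  by apply: neq; rewrite e ?size_bits.
have size_nJ : size (map negb J) = (m + m)%N by rewrite size_map.
have le_m : (m <= count id (map negb J))%N.
  rewrite count_map -(leq_add2l (count id J)) count_predC size_J.
  by rewrite leq_add2r ltnW.
eexists; split; first exact: isometric_copy_box size_b size_nJ lt_b le_m.
left=> _ _ [x cx <-] [y cy <-].
have [||_ ->] := can_b (spread (map negb J) (bits x)) (spread (map negb J) (bits y));
  by rewrite ?size_spread // !mask_spread_negb.
Qed.
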